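(* For every $0<\zeta<1$, every graph $G=(V,E)$ with edge weights $w_{uv}\in\{0\}\cup[1,+\infty)$ has a partition $V=V_1\cup\cdots\cup V_k$ such that $\Phi(V_i)\ge\frac{\zeta}{\log_{4/3}\mathrm{vol}(V)}$ for all $i$, and $\sum_{i<j}w(V_i,V_j)\le\frac{3\zeta}{2}\mathrm{vol}(V)$.
   Context: For $S,T\subseteq V$ (not necessarily disjoint), $w(S,T)=\sum_{u\in S,v\in T}w_{uv}$ (weights symmetric, self-loops allowed), and $\mathrm{vol}(S)=w(S,V)$ (volume taken in the whole graph $G$). For disjoint $S,T$, the cut conductance is $\varphi(S,T)=\frac{w(S,T)}{\min\{\mathrm{vol}(S),\mathrm{vol}(T)\}}$. For $H\subseteq V$, the conductance of $H$ embedded in $G$ is $\Phi(H)=\min_{S'\subseteq H}\varphi(S',H\setminus S')$, the minimum over nonempty proper subsets $S'$ of $H$. *)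

(* Defs.v *)
From mathcomp Require Import all_boot all_order all_algebra.
From mathcomp Require Import reals constructive_ereal exp.

Set Implicit Arguments.
Unset Strict Implicit.
Unset Printing Implicit Defensive.

Import Order.TTheory GRing.Theory Num.Theory.
Local Open Scope ring_scope.

Section Conductance.
Variables (R : realType) (V : finType) (w : V -> V -> R).
Implicit Types S T H : {set V}.

(* Sum over ordered pairs: in [cut_weight S S] an edge between distinct vertices
   counts twice and a self-loop once. *)
Definition cut_weight S T : R := \sum_(u in S) \sum_(v in T) w u v.

Definition vol S : R := cut_weight S [set: V].

(* If S or T has volume 0, the quotient is 0 / 0, which is 0 here. *)
Definition cut_conductance S T : R :=
  cut_weight S T / Num.min (vol S) (vol T).

(* Extended-real valued: the minimum over the empty family is +oo, so a
   singleton has conductance +oo. *)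
Definition conductance H : \bar R :=
  \big[Order.min/+oo%E]_(S : {set V} | (S != set0) && (S \proper H))
    (cut_conductance S (H :\: S))%:E.

End Conductance.

Definition log_base (R : realType) (b x : R) : R := ln x / ln b.

(* Main.v *)
Require Import Defs.
From mathcomp Require Import all_boot all_order all_algebra.
From mathcomp Require Import reals constructive_ereal exp.
From mathcomp Require Import lra.

Set Implicit Arguments.
Unset Strict Implicit.
Unset Printing Implicit Defensive.

Import Order.TTheory GRing.Theory Num.Theory.
Local Open Scope ring_scope.

(** As long as some block H has a cut (S, H \ S) of conductance below
    tau = zeta / log_{4/3} vol(V), split H along it. A cut of weight at most
    tau * min(a, b), where a = vol(S) and b = vol(H \ S), is paid for by the
    superadditivity gap of x |-> x * log_2 x, since
    min(a, b) + a log_2 a + b log_2 b <= (a + b) log_2 (a + b).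
    Hence the total cut weight is at most
    tau * vol(V) * log_2 vol(V) = zeta * vol(V) * log_2 (4 / 3). *)

Section PartitionUnion.
Variables (V : finType) (P Q : {set {set V}}) (S T : {set V}).
Hypotheses (PS : partition P S) (QT : partition Q T) (ST : [disjoint S & T]).

(** A common block would lie in the empty set [S :&: T], yet blocks are nonempty. *)
Lemma partition_disjoint : [disjoint P & Q].
Proof.
rewrite disjoint_subset; apply/subsetP => A AP; rewrite inE; apply/negP => AQ.
have : A \subset S :&: T by rewrite subsetI (partitionS PS AP) (partitionS QT AQ).
by rewrite (disjoint_setI0 ST) subset0 (negPf (partition_neq0 PS AP)).
Qed.

Lemma partitionU : partition (P :|: Q) (S :|: T).
Proof.
have [/and3P[/eqP covP trP nP] /and3P[/eqP covQ trQ nQ]] := (PS, QT).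
apply/and3P; split; last by rewrite inE negb_or nP.
  by rewrite /cover bigcup_setU -/(cover P) -/(cover Q) covP covQ.
by apply: trivIsetU => //; rewrite covP covQ.
Qed.

End PartitionUnion.

(** By symmetry let [a <= b]. Then [2 * a <= a + b] gives [ln 2 + ln a <= ln (a + b)], while
    [ln b <= ln (a + b)]; weight these by [a] and [b] and add. *)
Lemma xlnx_superadditive (R : realType) (a b : R) : 0 <= a -> 0 <= b ->
  ln 2 * Num.min a b + a * ln a + b * ln b <= (a + b) * ln (a + b).
Proof.
wlog ab : a b / a <= b => [wl a0 b0|].
  have [ab|/ltW ba] := leP a b; first by have := wl a b ab a0 b0; rewrite min_l.
  by have := wl b a ba b0 a0; rewrite min_l// (addrC b a); lra.
rewrite min_l// le0r => /orP[/eqP->|a0] b0; first by rewrite mulr0 mul0r !add0r.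
have b_gt0 : 0 < b by apply: lt_le_trans ab.
have ab0 : 0 < a + b by apply: addr_gt0.
have ln2a : ln 2 + ln a <= ln (a + b).
  by rewrite -lnM ?posrE// ler_ln ?posrE ?mulr_gt0//; lra.
have lnb : ln b <= ln (a + b) by rewrite ler_ln ?posrE//; lra.
have := ler_wpM2l (ltW a0) ln2a; have := ler_wpM2l b0 lnb; lra.
Qed.

Section CutWeight.
Variables (R : realType) (V : finType) (w : V -> V -> R).
Hypothesis w_sym : forall u v, w u v = w v u.
Implicit Types (S T U H : {set V}) (P : {set {set V}}).

Lemma cut_weightC S T : cut_weight w S T = cut_weight w T S.
Proof.
rewrite /cut_weight exchange_big; apply: eq_bigr => u _.
by apply: eq_bigr => v _; apply: w_sym.
Qed.

Lemma cut_weight_splitl S T U : S \subset T ->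
  cut_weight w T U = cut_weight w S U + cut_weight w (T :\: S) U.
Proof. by move=> sST; rewrite /cut_weight (big_setID S) /= (setIidPr sST). Qed.

Lemma vol_split S T : S \subset T -> vol w T = vol w S + vol w (T :\: S).
Proof. exact: cut_weight_splitl. Qed.

Lemma cut_weight_split S T : S \subset T ->
  cut_weight w T T = cut_weight w S S + cut_weight w (T :\: S) (T :\: S)
                     + 2 * cut_weight w S (T :\: S).
Proof.
move=> sST; rewrite (cut_weight_splitl T sST).
rewrite (cut_weightC S T) (cut_weightC (T :\: S) T) !(cut_weight_splitl _ sST).
by rewrite (cut_weightC (T :\: S) S); lra.
Qed.

Lemma cut_weight_partition (I : finType) (C : I -> {set V}) :
  injective C -> partition [set C i | i : I] [set: V] ->
  cut_weight w [set: V] [set: V] = \sum_i \sum_j cut_weight w (C i) (C j).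
Proof.
move=> C_inj CP.
have sumC (F : V -> R) : \sum_(v in [set: V]) F v = \sum_i \sum_(v in C i) F v.
  by rewrite (set_partition_big _ CP) /= big_imset //= => i j _ _ /C_inj.
rewrite /cut_weight sumC; apply: eq_bigr => i _.
rewrite [RHS]exchange_big; apply: eq_bigr => u _; exact: sumC.
Qed.

Lemma double_sum_sym n (F : 'I_n -> 'I_n -> R) : (forall i j, F i j = F j i) ->
  \sum_i \sum_j F i j
  = \sum_i F i i + 2 * \sum_(i < n) \sum_(j < n | (i < j)%N) F i j.
Proof.
move=> F_sym.
have -> : \sum_i \sum_j F i j = \sum_i F i i
    + \sum_(i < n) \sum_(j < n | (i < j)%N) F i j
    + \sum_(i < n) \sum_(j < n | (j < i)%N) F i j.
  rewrite -!big_split /=; apply: eq_bigr => i _.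
  rewrite (bigD1 i) //= -addrA; congr (_ + _).
  rewrite (bigID (fun j : 'I_n => (i < j)%N)) /=; congr (_ + _);
    apply: eq_bigl => j; rewrite -val_eqE /=; case: ltngtP => //.
rewrite mulr_natl mulr2n [RHS]addrA; congr (_ + _).
rewrite (exchange_big_dep predT) //=.
by apply: eq_bigr => i _; apply: eq_bigr => j _; apply: F_sym.
Qed.

Hypothesis w_range : forall u v, w u v = 0 \/ 1 <= w u v.

Lemma weight_ge0 u v : 0 <= w u v.
Proof. by have [->//|/(le_trans ler01)] := w_range u v. Qed.

Lemma cut_weight_ge0 S T : 0 <= cut_weight w S T.
Proof. by apply: sumr_ge0 => u _; apply: sumr_ge0 => v _; apply: weight_ge0. Qed.

Lemma cut_weight_le_vol S T : cut_weight w S T <= vol w S.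
Proof.
rewrite /vol cut_weightC [leRHS]cut_weightC (cut_weight_splitl _ (subsetT T)).
by rewrite lerDl cut_weight_ge0.
Qed.

(** The quotient can be cleared even when the smaller volume is 0: the cut weighs at most either
    volume, so it vanishes too. *)
Lemma cut_weight_le_cut_conductance S T (tau : R) :
  cut_conductance w S T <= tau ->
  cut_weight w S T <= tau * Num.min (vol w S) (vol w T).
Proof.
rewrite /cut_conductance; set m := Num.min _ _.
have cut_le : cut_weight w S T <= m.
  by rewrite le_min cut_weight_le_vol cut_weightC cut_weight_le_vol.
have := le_trans (cut_weight_ge0 S T) cut_le.
rewrite le0r => /orP[/eqP m0|m_gt0]; last by rewrite ler_pdivrMr.
by rewrite m0 mulr0 -m0.
Qed.

(** One nonzero weight already contributes 1, and the other terms are nonnegative. This gap keeps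
    logarithms of volumes nonnegative. *)
Lemma cut_weight_eq0_or_ge1 S T : cut_weight w S T = 0 \/ 1 <= cut_weight w S T.
Proof.
have [wST0|] := boolP [forall u in S, forall v in T, w u v == 0].
  left; rewrite /cut_weight big1 // => u uS; rewrite big1 // => v vT.
  exact/eqP/(forall_inP (forall_inP wST0 u uS)).
rewrite negb_forall_in => /exists_inP[u uS].
rewrite negb_forall_in => /exists_inP[v vT wuv0]; right.
have [wuv|wuv1] := w_range u v; first by rewrite wuv eqxx in wuv0.
rewrite /cut_weight (bigD1 u) //= (bigD1 v) //= -addrA (le_trans wuv1) // lerDl.
rewrite addr_ge0 ?sumr_ge0 // => [|x _]; last rewrite sumr_ge0 // => y _.
  by move=> x _; apply: weight_ge0.
exact: weight_ge0.
Qed.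

(** Strong induction on the size of [H], cutting until blocks are [good]. The difference on the left
    is twice the weight between distinct blocks; the factor [ln 2] turns the base-2 logarithm into
    [ln]. *)
Lemma sparse_cut_partition (good : pred {set V}) (tau : R) H : 0 <= tau ->
  (forall T, good T \/ exists S, [/\ S != set0, S \proper T &
     cut_weight w S (T :\: S) <= tau * Num.min (vol w S) (vol w (T :\: S))]) ->
  exists P, [/\ partition P H, forall T, T \in P -> good T &
    ln 2 * (cut_weight w H H - \sum_(T in P) cut_weight w T T)
      <= 2 * tau * (vol w H * ln (vol w H))].
Proof.
move=> tau0 good_or_cut.
have [n] := ubnP #|H|; elim: n H => // n IHn H Hn.
(* The empty set gets the partition without blocks, since [[set set0]] is not a partition. *)
have [->|H0] := eqVneq H set0.
  exists set0; split=> [|T|]; rewrite ?inE//.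
    by rewrite /partition /trivIset /cover !big_set0 cards0 inE !eqxx.
  by rewrite /vol /cut_weight !big_set0 subrr mul0r !mulr0.
have [gH|[S [S0 pSH cutS]]] := good_or_cut H.
  exists [set H]; split=> [|T|].
  - by rewrite /partition /trivIset /cover !big_set1 !eqxx inE eq_sym.
  - by rewrite inE => /eqP ->.
  (* A single block costs nothing, so only the sign of the bound matters; it holds because a volume
     is 0 or at least 1. *)
  rewrite big_set1 subrr mulr0; apply: mulr_ge0; first exact: mulr_ge0.
  have [vol0|vol1] := cut_weight_eq0_or_ge1 H setT; first by rewrite /vol vol0 mul0r.
  by rewrite mulr_ge0 ?cut_weight_ge0 ?ln_ge0.
have sSH := proper_sub pSH.
have [P [PS gP costP]] := IHn S (leq_trans (proper_card pSH) Hn).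
have [|Q [QT gQ costQ]] := IHn (H :\: S).
  rewrite -ltnS; apply: leq_trans Hn; rewrite ltnS cardsDS// ltn_subrL.
  by rewrite !card_gt0 S0.
have SHS : [disjoint S & H :\: S] by rewrite disjoints_subset setCD subsetUr.
exists (P :|: Q); split=> [|T|].
- by rewrite -(setID H S) (setIidPr sSH) partitionU.
- by rewrite inE => /orP[/gP|/gQ].
rewrite (eq_bigl [predU P & Q]) => [|T]; last by rewrite !inE.
rewrite bigU ?(partition_disjoint PS QT)//= (cut_weight_split sSH) (vol_split sSH).
have ln2_gt0 : 0 < ln 2 :> R by rewrite ln_gt0// ltr1n.
(* The cost of [H] is the cost of both sides plus twice the new cut, and [tau] times the
   superadditivity gap pays for that cut. *)
have := ler_wpM2l (ltW ln2_gt0) cutS.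
have := ler_wpM2l tau0
  (xlnx_superadditive (cut_weight_ge0 S setT) (cut_weight_ge0 (H :\: S) setT)).
rewrite -!/(vol w _); lra.
Qed.

End CutWeight.

Theorem theorem4 (R : realType) (zeta : R) (zeta_gt0 : 0 < zeta)
    (zeta_lt1 : zeta < 1) (V : finType) (w : V -> V -> R)
    (w_sym : forall u v : V, w u v = w v u)
    (w_range : forall u v : V, w u v = 0 \/ 1 <= w u v) :
  exists (k : nat) (C : 'I_k -> {set V}),
    [/\ injective C /\ partition [set C i | i : 'I_k] [set: V],
        forall i : 'I_k,
          (zeta%:E / (log_base (4 / 3) (vol w [set: V]))%:E
             <= conductance w (C i))%E
      & \sum_(i < k) \sum_(j < k | (i < j)%N) cut_weight w (C i) (C j)
          <= 3 * zeta / 2 * vol w [set: V]].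
Proof.
set W := vol w [set: V]; set L := log_base (4 / 3) W.
set thr := (_ / _)%E.
have ln2_gt0 : 0 < ln 2 :> R by rewrite ln_gt0// ltr1n.
have ln43_gt0 : 0 < ln (4 / 3) :> R by rewrite ln_gt0//; lra.
have ln43_le2 : ln (4 / 3) <= ln 2 :> R by rewrite ler_ln ?posrE; lra.
have W_range : W = 0 \/ 1 <= W := cut_weight_eq0_or_ge1 w_range _ _.
have lnW_ge0 : 0 <= ln W by have [->|/ln_ge0//] := W_range; rewrite ln0.
have L_ge0 : 0 <= L by rewrite divr_ge0// ltW.
(* As [ln 0 = 0], [L = 0] means that [W] is 0 or 1. A nonzero cut weighs at least 1 and counts twice
   in [W], which would force [W >= 2]. *)
have L0_cut S T : L = 0 -> cut_weight w S (T :\: S) = 0.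
  move=> /eqP; rewrite mulf_eq0 invr_eq0 (gt_eqF ln43_gt0) orbF => lnW0.
  have W_le1 : W <= 1.
    have [->//|W1] := W_range.
    by move: lnW0; rewrite ln_eq0 ?(lt_le_trans _ W1)// => /eqP->.
  have [//|cut1] := cut_weight_eq0_or_ge1 w_range S (T :\: S).
  have := cut_weight_split w_sym (subsetT S).
  have := cut_weight_ge0 w_range S S.
  have := cut_weight_ge0 w_range (~: S) (~: S).
  have -> : cut_weight w [set: V] [set: V] = W by [].
  rewrite setTD; have : cut_weight w S (T :\: S) <= cut_weight w S (~: S).
    rewrite setDE (cut_weightC w_sym S) (cut_weightC w_sym S (~: S)).
    by rewrite (cut_weight_splitl _ _ (subsetIr T (~: S))) lerDl cut_weight_ge0.
  lra.
(* [zeta / 0 = 0] in [R], whereas [thr = +oo] when [L = 0]. *)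
pose tau := zeta / L.
have tau_ge0 : 0 <= tau by rewrite divr_ge0// ltW.
have good_or_cut T : (thr <= conductance w T)%E \/
    exists S, [/\ S != set0, S \proper T &
      cut_weight w S (T :\: S) <= tau * Num.min (vol w S) (vol w (T :\: S))].
  have [all_ge|] := boolP [forall S : {set V}, (S != set0) && (S \proper T) ==>
      (thr <= (cut_conductance w S (T :\: S))%:E)%E].
    left; apply/bigmin_geP; split=> [|S ST]; first exact: leey.
    by have := forallP all_ge S; rewrite ST.
  rewrite negb_forall => /existsP[S]; rewrite negb_imply -ltNge.
  move=> /andP[/andP[S0 ST] ltS]; right; exists S; split=> //.
  (* If [L = 0], the infinite threshold forces splitting down to singletons; every cut then has
     weight 0, so the bound with [tau = 0] holds. *)
  have [L0|L0] := eqVneq L 0.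
    by rewrite L0_cut// mulr_ge0// le_min !cut_weight_ge0.
  apply: cut_weight_le_cut_conductance => //.
  by move: ltS; rewrite /thr inver (negPf L0) -EFinM lte_fin => /ltW.
have [P [PV goodP costP]] :=
  sparse_cut_partition w_sym w_range [set: V] tau_ge0 good_or_cut.
exists #|P|, enum_val.
have imP : [set enum_val i | i : 'I_#|P|] = P.
  apply/setP => A; apply/imsetP/idP => [[i _ ->]|AP]; first exact: enum_valP.
  by exists (enum_rank_in AP A); rewrite ?enum_rankK_in.
have valP_partition : partition [set enum_val i | i : 'I_#|P|] [set: V].
  by rewrite imP.
split=> [|i|]; first by split; [exact: enum_val_inj|].
  exact/goodP/enum_valP.
set cost := (X in X <= _).
have costE : cut_weight w [set: V] [set: V] - \sum_(T in P) cut_weight w T T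
    = 2 * cost.
  rewrite (cut_weight_partition _ enum_val_inj valP_partition).
  rewrite double_sum_sym; last by move=> i j; apply: cut_weightC.
  by rewrite (big_enum_val (fun T => cut_weight w T T)) addrAC subrr add0r.
(* An equality unless [L = 0], where the left side is 0. *)
have tau_lnW : tau * ln W <= zeta * ln (4 / 3).
  have [L0|L0] := eqVneq L 0.
    by rewrite /tau L0 invr0 mulr0 mul0r mulr_ge0// ltW.
  have -> : ln W = L * ln (4 / 3) by rewrite /L /log_base divfK// gt_eqF.
  by rewrite mulrA /tau divfK.
have W_ge0 : 0 <= W by apply: cut_weight_ge0.
(* With [ln (4 / 3) <= ln 2], the cost is at most [zeta * W], which the constant [3 / 2] covers. *)
rewrite -(ler_pM2l ln2_gt0).
move: costP; rewrite costE -/W.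
have := ler_wpM2r W_ge0 tau_lnW.
have := ler_wpM2l (mulr_ge0 (ltW zeta_gt0) W_ge0) ln43_le2.
have := mulr_ge0 (mulr_ge0 (ltW zeta_gt0) W_ge0) (ltW ln2_gt0).
lra.
Qed.
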